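(* Let $q\ge1$, let $F\colon X\rightrightarrows Y$ be a set-valued mapping between Banach spaces with $(\bar x,\bar y)\in\mathrm{gph}\,F$, and let $g\colon X\to Y$ be a single-valued mapping that is locally Lipschitzian around $\bar x$. Assume that there exist $\kappa,\lambda\in(0,\infty)$ such that $$\mathrm{ssubreg}^q F(\bar x,\bar y)<\kappa\quad\text{and}\quad \mathrm{lip}\,g(\bar x)<\lambda<\big(\kappa^{1/q}\big)^{-1}.$$ Then, with $\tilde F(x):=F(x)-g(\bar x)$, we have $$\mathrm{ssubreg}^q(\tilde F+g)(\bar x,\bar y)\le\frac{\kappa}{\big(1-\lambda\kappa^{1/q}\big)^q}.$$ Furthermore, if $\mathrm{ssubreg}^qF(\bar x,\bar y)>0$, then $$\mathrm{ssubreg}^q(\tilde F+g)(\bar x,\bar y)\le\frac{\mathrm{ssubreg}^qF(\bar x,\bar y)}{\Big(1-\big(\mathrm{ssubreg}^qF(\bar x,\bar y)\big)^{1/q}\,\mathrm{lip}\,g(\bar x)\Big)^q}$$ whenever $\big(\mathrm{ssubreg}^qF(\bar x,\bar y)\big)^{1/q}\,\mathrm{lip}\,g(\bar x)<1$.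
   Context: $\mathbb{B}(x,r)$ is the closed ball of center $x$ and radius $r$; $d(y;\Omega)=\inf_{w\in\Omega}\|y-w\|$, with $d(y;\emptyset)=\infty$; $\mathrm{gph}\,F=\{(x,y):y\in F(x)\}$. A set-valued mapping $F\colon X\rightrightarrows Y$ with $(\bar x,\bar y)\in\mathrm{gph}\,F$ is strongly metrically $q$-subregular at $(\bar x,\bar y)$ if there are $\eta,\gamma>0$ such that $$\|x-\bar x\|\le\eta\,\big[d\big(\bar y;F(x)\big)\big]^q\quad\text{for all }x\in\mathbb{B}(\bar x,\gamma).$$ The exact strong $q$-subregularity bound $\mathrm{ssubreg}^qF(\bar x,\bar y)\in[0,\infty]$ is the infimum of all $\eta>0$ for which this holds with some $\gamma>0$ (it equals $\infty$ if there is no such $\eta$); the superscript $q$ in $\mathrm{ssubreg}^q$ is a label, not a power. For $g$ locally Lipschitzian around $\bar x$, $\displaystyle\mathrm{lip}\,g(\bar x):=\limsup_{x,u\to\bar x,\ x\ne u}\frac{\|g(x)-g(u)\|}{\|x-u\|}$. $(\tilde F+g)(x)=\{y-g(\bar x)+g(x): y\in F(x)\}$. *)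

(* Defs.v *)
From mathcomp Require Import all_boot all_order all_algebra.
From mathcomp Require Import all_classical all_reals all_analysis.

Set Implicit Arguments.
Unset Strict Implicit.
Unset Printing Implicit Defensive.

Import Order.TTheory GRing.Theory Num.Theory.
Import numFieldNormedType.Exports.

Local Open Scope classical_set_scope.
Local Open Scope ring_scope.

(* Set-valued mappings [X ==> Y] are functions [X -> set Y]. *)
Definition gph (X Y : Type) (F : X -> set Y) : set (X * Y) :=
  [set p | F p.1 p.2].

(* Extended-real valued, since [ereal_inf set0 = +oo]. *)
Definition dist_to (R : realType) (Y : normedModType R) (y : Y)
    (Omega : set Y) : \bar R :=
  ereal_inf [set `|y - w|%:E | w in Omega].

(* The [q]-th power of the distance is taken in [\bar R]: for [0 < q], it is
   [+oo] when [F x] is empty, in which case the estimate holds at [x]. *)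
Definition strong_subreg_with (R : realType) (X Y : normedModType R) (q : R)
    (F : X -> set Y) (xbar : X) (ybar : Y) (eta gamma : R) : Prop :=
  forall x : X, closed_ball_ Num.norm xbar gamma x ->
    (`|x - xbar|%:E <= eta%:E * dist_to ybar (F x) `^ q)%E.

Definition ssubreg (R : realType) (X Y : normedModType R) (q : R)
    (F : X -> set Y) (xbar : X) (ybar : Y) : \bar R :=
  ereal_inf [set eta%:E | eta in
    [set eta : R | 0 < eta /\
       exists2 gamma : R, 0 < gamma &
         strong_subreg_with q F xbar ybar eta gamma]].

Definition locally_lipschitz_at (R : realType) (X Y : normedModType R)
    (g : X -> Y) (xbar : X) : Prop :=
  exists2 U : set X, nbhs xbar U & [lipschitz g x | x in U].

(* The upper limit over [x, u --> xbar], [x != u]; [x] or [u] may be [xbar].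
   If [X] is the zero space there is no pair [x != u] and the value is [-oo]. *)
Definition lip_modulus (R : realType) (X Y : normedModType R)
    (g : X -> Y) (xbar : X) : \bar R :=
  limf_esup (fun p : X * X => (`|g p.1 - g p.2| / `|p.1 - p.2|)%:E)
    (within [set p : X * X | p.1 != p.2] (nbhs (xbar, xbar))).

Definition sv_shift (X : Type) (Y : zmodType) (F : X -> set Y) (c : Y)
  : X -> set Y := fun x => [set y - c | y in F x].

Definition sv_add (X : Type) (Y : zmodType) (F : X -> set Y) (g : X -> Y)
  : X -> set Y := fun x => [set y + g x | y in F x].

(* Main.v *)
Require Import Defs.
From mathcomp Require Import all_boot all_order all_algebra.
From mathcomp Require Import all_classical all_reals all_analysis.
From mathcomp Require Import lra.

Set Implicit Arguments.
Unset Strict Implicit.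
Unset Printing Implicit Defensive.

Import Order.TTheory GRing.Theory Num.Theory.
Import numFieldNormedType.Exports.

Local Open Scope classical_set_scope.
Local Open Scope ring_scope.

(** Write [z = y - g xbar + g x] with [y] in [F x]. Then
    [`|ybar - y| <= `|ybar - z| + l * `|x - xbar|], so the subregularity estimate
    for [F] with modulus [k] bounds [`|x - xbar| `^ q^-1] by
    [k `^ q^-1 * (`|ybar - z| + l * `|x - xbar|)]. For [`|x - xbar| <= 1] the last
    term is absorbed on the left, because there [`|x - xbar|] is at most its
    [q]-th root. The sharp bound follows by letting [k] and [l] decrease to
    [ssubreg q F xbar ybar] and [lip_modulus g xbar]; the latter is a nonnegative
    real since [0 < ssubreg q F xbar ybar] makes [xbar] a non-isolated point. *)

Lemma powRVK (R : realType) (q a : R) : q != 0 -> 0 <= a ->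
  (a `^ q^-1) `^ q = a.
Proof. by move=> q0 a0; rewrite -powRrM mulVf// powRr1. Qed.

Lemma continuous_powR (R : realType) (r a : R) : 0 < a ->
  {for a, continuous (fun x : R => x `^ r)}.
Proof.
move=> a0; apply/differentiable_continuous/derivable1_diffP.
by apply: derivable_powR; rewrite in_itv/= a0.
Qed.

Lemma ge0_lee_poweR (R : realType) (r : R) (x y : \bar R) :
  0 <= r -> (0 <= x)%E -> (x <= y)%E -> (x `^ r <= y `^ r)%E.
Proof.
move=> r0 x0 xy; apply: gt0_ler_poweR => //; rewrite in_itv/= leey andbT//.
exact: le_trans xy.
Qed.

Lemma dist_to_ge0 (R : realType) (Y : normedModType R) (y : Y) (A : set Y) :
  (0 <= dist_to y A)%E.
Proof. by apply: le_ereal_inf_tmp => _ [w _ <-]; rewrite lee_fin. Qed.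

Lemma lee_powR_dist_to (R : realType) (Y : normedModType R) (q c d : R)
    (y : Y) (A : set Y) : 0 < q -> 0 < c -> 0 <= d ->
  (d%:E <= c%:E * dist_to y A `^ q)%E <->
  (forall w, A w -> d <= c * `|y - w| `^ q).
Proof.
move=> q0 c0 d0; split=> [le_d w Aw|le_d].
  rewrite -lee_fin (le_trans le_d)// EFinM -poweR_EFin lee_pmul2l//.
  apply: ge0_lee_poweR; rewrite ?dist_to_ge0 ?(ltW q0)//.
  by apply: ereal_inf_lbound; exists w.
have dc0 : 0 <= d / c by rewrite divr_ge0// ltW.
have -> : d = c * (((d / c) `^ q^-1) `^ q).
  by rewrite powRVK ?gt_eqF// mulrC divfK// gt_eqF.
rewrite EFinM -poweR_EFin lee_pmul2l//.
apply: ge0_lee_poweR; rewrite ?(ltW q0) ?lee_fin ?powR_ge0//.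
apply: le_ereal_inf_tmp => _ [w Aw <-]; rewrite lee_fin.
rewrite -(@powRr1 _ `|y - w|)// -(@mulfV _ q) ?gt_eqF// powRrM.
rewrite ge0_ler_powR ?nnegrE ?powR_ge0 ?invr_ge0 ?(ltW q0)//.
by rewrite ler_pdivrMr// mulrC le_d.
Qed.

(* Since [d <= 1] and [q >= 1], [d <= d `^ q^-1]: the perturbation [l * d] can
   therefore be absorbed after taking [q]-th roots. *)
Lemma absorb_perturbation (R : realType) (q k l d a b : R) :
  1 <= q -> 0 < k -> 0 < l -> l * k `^ q^-1 < 1 ->
  0 <= d <= 1 -> 0 <= a -> 0 <= b ->
  d <= k * a `^ q -> a <= b + l * d ->
  d <= k / (1 - l * k `^ q^-1) `^ q * b `^ q.
Proof.
move=> q1 k0 l0 lk1 /andP[d0 d1] a0 b0 dka abd.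
have q0 : 0 < q by lra.
set K := k `^ q^-1 in lk1 *; set D := d `^ q^-1.
have K0 : 0 < K by exact: powR_gt0.
have dD : d <= D.
  have [->|dneq0] := eqVneq d 0; first exact: powR_ge0.
  by rewrite ger1_powR ?invf_le1// lt0r dneq0 d0.
have DKa : D <= K * a.
  have -> : K * a = (k * a `^ q) `^ q^-1.
    rewrite powRM ?powR_ge0 1?ltW// -powRrM mulfV ?gt_eqF// powRr1//.
  by rewrite ge0_ler_powR ?nnegrE ?mulr_ge0 ?powR_ge0 ?invr_ge0 ?(ltW q0) ?(ltW k0).
(* Chain: [D <= K * a <= K * b + K * l * d <= K * b + K * l * D]. *)
have D_le : D * (1 - l * K) <= K * b.
  have : K * a <= K * (b + l * d) by rewrite ler_pM2l.
  have : K * l * d <= K * l * D by rewrite ler_pM2l// mulr_gt0.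
  by lra.
have den0 : 0 < 1 - l * K by lra.
rewrite -(@powRVK _ q d) ?gt_eqF// -/D -{1}(@powRVK _ q k) ?gt_eqF ?(ltW k0)// -/K.
have -> : K `^ q / (1 - l * K) `^ q * b `^ q = (K * b / (1 - l * K)) `^ q.
  rewrite powRM ?invr_ge0 ?(ltW den0) ?mulr_ge0 ?(ltW K0)// powRM ?(ltW K0)//.
  by rewrite -(powR_inv1 (ltW den0)) powRAC powR_inv1 ?powR_ge0// mulrAC.
rewrite ge0_ler_powR ?nnegrE ?powR_ge0 ?divr_ge0 ?mulr_ge0 ?(ltW K0) ?(ltW den0) ?(ltW q0)//.
by rewrite ler_pdivlMr.
Qed.

(** The upper limit runs over all pairs of distinct points near [x0], so the second point may be
    frozen at [x0] itself. *)
Lemma lip_modulus_lt_near (R : realType) (X Y : normedModType R)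
    (g : X -> Y) (x0 : X) (l : R) : (lip_modulus g x0 < l%:E)%E ->
  \forall x \near x0, `|g x - g x0| <= l * `|x - x0|.
Proof.
move=> /ereal_inf_lt[_ [V nV <-]] supVl.
move: nV => -[[A B]/= [nA nB] ABV].
near=> x.
have [->|xx0] := eqVneq x x0; first by rewrite !subrr !normr0 mulr0.
rewrite -ler_pdivrMr ?normr_gt0 ?subr_eq0// -lee_fin.
apply: le_trans (ltW supVl); apply: ereal_sup_ubound; exists (x, x0) => //=.
apply: ABV => //=; split => /=; last exact: nbhs_singleton.
by near: x.
Unshelve. all: by end_near. Qed.

Lemma ssubreg_perturb_le (R : realType) (X Y : normedModType R)
    (q : R) (F : X -> set Y) (g : X -> Y) (xbar : X) (ybar : Y) (k l : R) :
  1 <= q -> 0 < k -> 0 < l -> l * k `^ q^-1 < 1 ->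
  (ssubreg q F xbar ybar < k%:E)%E -> (lip_modulus g xbar < l%:E)%E ->
  (ssubreg q (sv_add (sv_shift F (g xbar)) g) xbar ybar
     <= (k / (1 - l * k `^ q^-1) `^ q)%:E)%E.
Proof.
move=> q1 k0 l0 lk1 /ereal_inf_lt[_ [eta [eta0 [gam gam0 regF]] <-]].
rewrite lte_fin => etak /lip_modulus_lt_near/nbhs_ballP[r /= r0 lipg].
have q0 : 0 < q by lra.
have C0 : 0 < k / (1 - l * k `^ q^-1) `^ q.
  by rewrite divr_gt0// powR_gt0// subr_gt0.
apply: ereal_inf_lbound; eexists; last reflexivity; split=> //.
(* Radius [1] allows the absorption, [gam] the estimate for [F], and [r / 2] puts the closed ball
   inside the open ball where [lipg] holds. *)
exists (Num.min 1 (Num.min gam (r / 2))).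
  by rewrite !lt_min ltr01 gam0 divr_gt0.
move=> x; rewrite /closed_ball_/= distrC !le_min => /and3P[d1 dgam dr].
apply/lee_powR_dist_to => //= _ [_ [y Fxy <-] <-].
have xgam : closed_ball_ Num.norm xbar gam x by rewrite /closed_ball_/= distrC.
apply: (absorb_perturbation (a := `|ybar - y|) q1 k0 l0 lk1) => //.
- by rewrite normr_ge0.
- apply: (@le_trans _ _ (eta * `|ybar - y| `^ q)).
    by move: (regF x xgam) => /lee_powR_dist_to; apply.
  by rewrite ler_wpM2r ?powR_ge0// ltW.
- have /= gx := lipg x _.
  apply: (@le_trans _ _ (`|ybar - (y - g xbar + g x)| + `|g x - g xbar|)).
    apply: le_trans (ler_normD _ _); rewrite le_eqVlt; apply/orP; left.
    apply/eqP; congr Num.norm.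
    by rewrite !opprD opprK !addrA addrNK addrK.
  rewrite lerD2l gx// -ball_normE /ball_/= distrC.
  by rewrite (le_lt_trans dr)// ltr_pdivrMr// ltr_pMr// ltr1n.
Qed.

Lemma ssubreg_ge0 (R : realType) (X Y : normedModType R) (q : R)
    (F : X -> set Y) (xbar : X) (ybar : Y) : (0 <= ssubreg q F xbar ybar)%E.
Proof. by apply: le_ereal_inf_tmp => _ [e [e0 _] <-]; rewrite lee_fin ltW. Qed.

(** If [xbar] were isolated, a small closed ball would reduce to [xbar], where the estimate has left
    side [0]; every [e > 0] would then be admissible and the infimum would be [0]. *)
Lemma nontrivial_of_ssubreg_gt0 (R : realType) (X Y : normedModType R) (q : R)
    (F : X -> set Y) (xbar : X) (ybar : Y) :
  (0 < ssubreg q F xbar ybar)%E ->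
  forall r : R, 0 < r -> exists2 x, ball xbar r x & x != xbar.
Proof.
move=> s0 r r0; apply: contrapT => isolated.
have s_le (e : R) : 0 < e -> (ssubreg q F xbar ybar <= e%:E)%E.
  move=> e0; apply: ereal_inf_lbound; exists e => //; split=> //.
  exists (r / 2) => [|x xr]; first exact: divr_gt0.
  suff -> : x = xbar.
    by rewrite subrr normr0 mule_ge0 ?poweR_ge0// lee_fin ltW.
  apply: contrapT => /eqP xx; apply: isolated; exists x => //.
  rewrite -ball_normE /ball_/= (le_lt_trans xr)//.
  by rewrite ltr_pdivrMr// ltr_pMr// ltr1n.
have [e e0 es] : exists2 e : R, 0 < e & (e%:E < ssubreg q F xbar ybar)%E.
  case: (ssubreg q F xbar ybar) s0 => [t| |]//; last by exists 1; rewrite ?ltry.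
  by rewrite lte_fin => t0; exists (t / 2); rewrite ?divr_gt0// lte_fin; lra.
by have := lt_le_trans es (s_le e e0); rewrite ltxx.
Qed.

(** The quotients are nonnegative, and non-isolation makes the filter of pairs of distinct points
    proper, which excludes the value [-oo]. *)
Lemma lip_modulus_ge0 (R : realType) (X Y : normedModType R)
    (g : X -> Y) (x0 : X) :
  (forall r : R, 0 < r -> exists2 x, ball x0 r x & x != x0) ->
  (0 <= lip_modulus g x0)%E.
Proof.
move=> nonisolated; apply: limf_esup_ge0; last first.
  by move=> p; rewrite lee_fin divr_ge0.
case=> -[A B]/= [/nbhs_ballP[r /= r0 rA] /nbhs_singleton Bx0] AB0.
have [x xr xx0] := nonisolated r r0.
by apply: (AB0 (x, x0)) => //=; split => //; exact: rA.
Qed.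

Theorem theorem4p1 (R : realType) (X Y : completeNormedModType R)
    (q : R) (hq : 1 <= q)
    (F : X -> set Y) (xbar : X) (ybar : Y) (hF : gph F (xbar, ybar))
    (g : X -> Y) (hg : locally_lipschitz_at g xbar)
    (kappa lambda : R) (hkappa : 0 < kappa) (hlambda : 0 < lambda)
    (hFkappa : (ssubreg q F xbar ybar < kappa%:E)%E)
    (hglambda : (lip_modulus g xbar < lambda%:E)%E)
    (hlambdakappa : lambda < (kappa `^ q^-1)^-1) :
  let Ftilde := sv_shift F (g xbar) in
  (ssubreg q (sv_add Ftilde g) xbar ybar
     <= (kappa / (1 - lambda * kappa `^ q^-1) `^ q)%:E)%E /\
  ((0 < ssubreg q F xbar ybar)%E ->
   (ssubreg q F xbar ybar `^ q^-1 * lip_modulus g xbar < 1)%E ->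
   (ssubreg q (sv_add Ftilde g) xbar ybar
     <= ssubreg q F xbar ybar
        / (1 - ssubreg q F xbar ybar `^ q^-1 * lip_modulus g xbar) `^ q)%E).
Proof.
move=> Ftilde.
have first_bound : (ssubreg q (sv_add Ftilde g) xbar ybar
    <= (kappa / (1 - lambda * kappa `^ q^-1) `^ q)%:E)%E.
  apply: ssubreg_perturb_le => //.
  by move: hlambdakappa; rewrite -(ltr_pdivlMr lambda 1 (powR_gt0 _ hkappa)) div1r.
split=> // s0 sl1.
have := lip_modulus_ge0 g (nontrivial_of_ssubreg_gt0 s0).
have := @ssubreg_perturb_le R X Y q F g xbar ybar _ _ hq.
rewrite -/Ftilde; move: s0 sl1 hFkappa hglambda first_bound.
have := ssubreg_ge0 q (sv_add Ftilde g) xbar ybar.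
(* All three moduli are finite: [kappa], [lambda] and [first_bound] exclude [+oo], nonnegativity
   excludes [-oo]. *)
case: (ssubreg q F xbar ybar) => [s| |]//.
case: (lip_modulus g xbar) => [l| |]//.
case: (ssubreg q (sv_add Ftilde g) xbar ybar) => [t| |]// _.
rewrite poweR_EFin -(EFinM (s `^ q^-1) l).
move=> s0 sl1 _ _ _ bound l0; rewrite !lte_fin lee_fin in s0 sl1 l0.
have den0 : 0 < 1 - s `^ q^-1 * l by rewrite subr_gt0.
rewrite -EFinD poweR_EFin inver gt_eqF ?powR_gt0// -EFinM lee_fin.
(* The first bound with [s + e] for [kappa] and [l + e] for [lambda]; both are positive and strictly
   exceed the exact moduli, even when [l = 0]. *)
pose phi (e : R) := (s + e) / (1 - (l + e) * (s + e) `^ q^-1) `^ q.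
have cadd (c : R) : c + e @[e --> 0^'+] --> c.
  apply: cvg_at_right_filter; rewrite -[X in _ --> X]addr0.
  by apply: cvgD; [exact: cvg_cst | exact: cvg_id].
have cs : (s + e) `^ q^-1 @[e --> 0^'+] --> s `^ q^-1.
  exact: continuous_cvg (continuous_powR s0) (cadd s).
have cden : 1 - (l + e) * (s + e) `^ q^-1 @[e --> 0^'+] --> 1 - s `^ q^-1 * l.
  by rewrite mulrC; apply: cvgB; [exact: cvg_cst | exact: cvgM].
(* For small [e] the denominator stays positive, which is the smallness condition needed to apply
   [bound]. *)
have nden := cvgr_gt _ cden _ den0.
have cphi : phi e @[e --> 0^'+] --> s / (1 - s `^ q^-1 * l) `^ q.
  apply: cvgM => //; apply: cvgV; first by rewrite gt_eqF ?powR_gt0.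
  exact: continuous_cvg (continuous_powR den0) cden.
rewrite -(cvg_lim _ cphi)//; apply: limr_ge; first exact: cvgP cphi.
near=> e.
have e0 : 0 < e by [].
rewrite -lee_fin; apply: bound; rewrite ?lte_fin ?ltrDl ?(ltr_wpDl l0 e0) ?addr_gt0//.
rewrite -subr_gt0; near: e; exact: nden _.
Unshelve. all: by end_near. Qed.
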